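(* There is a first-countable Hausdorff space $X$ such that there is no convergent strategy for Nonempty in the Choquet game $\mathsf{Ch}(X)$. Moreover, this space $X$ is the open continuous image of a metric space.
   Context: The Choquet game $\mathsf{Ch}(X)$ on a topological space $X$ is played by two players, Empty and Nonempty, for $\omega$ rounds. On round $i$, Empty moves first, choosing a point $x_i \in X$ and an open set $U_i$ with $x_i \in U_i$ and, if $i \geq 1$, $U_i \subseteq V_{i-1}$. Then Nonempty responds with an open set $V_i$ such that $x_i \in V_i \subseteq U_i$. Empty wins the play if $\bigcap_{n<\omega} V_n = \varnothing$; otherwise Nonempty wins. A strategy for Nonempty is a function $\mathfrak{S}$ which takes a partial play ending with a move by Empty and returns a legal open set for Nonempty to play. It is convergent if for any play $\langle x_i,U_i,V_i\rangle_{i<\omega}$ following $\mathfrak{S}$, the collection $\{V_i : i<\omega\}$ is a neighborhood basis for any point in $\bigcap_i V_i$. A convergent strategy is not required to be winning. $X$ is the open continuous image of a metric space $Y$ if there is an open continuous surjection $Y \to X$. *)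

(* Defs.v *)
From HB Require Import structures.
From mathcomp Require Import all_boot all_order all_algebra.
From mathcomp Require Import all_classical all_reals all_analysis.

Set Implicit Arguments.
Unset Strict Implicit.
Unset Printing Implicit Defensive.

Local Open Scope classical_set_scope.

Definition nbhs_basis {X : topologicalType} (p : X) (B : set (set X)) : Prop :=
  B `<=` nbhs p /\ filter_from B id --> p.

Definition first_countable (X : topologicalType) : Prop :=
  forall p : X, exists2 B : set (set X), countable B & nbhs_basis p B.

Definition open_map {Y X : topologicalType} (f : Y -> X) : Prop :=
  forall A : set Y, open A -> open (f @` A).

Section ChoquetGame.
Variable X : topologicalType.

Definition empty_move : Type := X * set X.

Definition nonempty_move : Type := set X.

Definition round : Type := empty_move * nonempty_move.

(* W is Nonempty's previous move, and setT on round 0: since U is a subset of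
   setT in any case, the first move of Empty is then unconstrained. *)
Definition legal_empty (W : set X) (m : empty_move) : Prop :=
  let: (x, U) := m in [/\ open U, U x & U `<=` W].

Definition legal_nonempty (m : empty_move) (V : nonempty_move) : Prop :=
  let: (x, U) := m in [/\ open V, V x & V `<=` U].

Fixpoint legal_after (W : set X) (h : seq round) (m : empty_move) : Prop :=
  if h is (m', V) :: h' then
    [/\ legal_empty W m', legal_nonempty m' V & legal_after V h' m]
  else legal_empty W m.

(* A partial play ending with a move by Empty consists of the list h of the
   completed rounds, oldest first, and Empty's move m on the current round. *)
Definition legal_partial_play (h : seq round) (m : empty_move) : Prop :=
  legal_after setT h m.

(* The values on illegal partial plays are irrelevant. *)
Definition is_strategy (S : seq round -> empty_move -> nonempty_move) : Prop :=
  forall h m, legal_partial_play h m -> legal_nonempty m (S h m).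

Definition legal_play (m : nat -> empty_move) (V : nat -> nonempty_move) :
    Prop :=
  forall i, legal_empty (if i is j.+1 then V j else setT) (m i) /\
            legal_nonempty (m i) (V i).

Definition follows (S : seq round -> empty_move -> nonempty_move)
    (m : nat -> empty_move) (V : nat -> nonempty_move) : Prop :=
  forall n, V n = S (mkseq (fun i => (m i, V i)) n) (m n).

Definition convergent (S : seq round -> empty_move -> nonempty_move) : Prop :=
  forall m V, legal_play m V -> follows S m V ->
    forall p, (\bigcap_i V i) p -> nbhs_basis p (range V).

End ChoquetGame.

(* Main.v *)
Require Import Defs.
From HB Require Import structures.
From mathcomp Require Import all_boot all_order all_algebra.
From mathcomp Require Import all_classical all_reals all_analysis.
From mathcomp Require Import lra.

Set Implicit Arguments.
Unset Strict Implicit.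
Unset Printing Implicit Defensive.

Local Open Scope classical_set_scope.

(** The space is the Sorgenfrey line. Against any strategy of Nonempty, Empty
   plays a strictly increasing sequence of points [x_n] with neighbourhoods
   [[x_n, b_n)] such that [[x_n, b_(n+1)]] is contained in [V_n]. Then
   [p = sup x_n] belongs to every [V_n], but no [V_n] is contained in the
   neighbourhood [[p, +oo)] of [p], since [x_n] is in [V_n].
   The metric space is Ponomarev's: its points are the points of [X] together
   with a sequence of open sets forming a neighbourhood basis, and its metric
   only depends on the first index at which two such sequences differ. *)

(** * The first-difference metric on sequences *)

Section FirstDifference.
Import Order.TTheory GRing.Theory Num.Theory.
Local Open Scope ring_scope.
Context {R : realType} {T : Type}.
Implicit Types a b c : nat -> T.

(** This is the usual metric of a Baire space, the countable power of the discrete space [T]. *)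
Definition first_diff_dist a b : R :=
  if pselect (exists n, `[< a n <> b n >]) is left e
  then (ex_minn e).+1%:R^-1 else 0.

Variant first_diff_dist_spec a b : R -> Prop :=
  | FirstDiffEq of a = b : first_diff_dist_spec a b 0
  | FirstDiffNeq k of a k <> b k & (forall i, (i < k)%N -> a i = b i) :
      first_diff_dist_spec a b k.+1%:R^-1.

Lemma first_diff_distP a b : first_diff_dist_spec a b (first_diff_dist a b).
Proof.
rewrite /first_diff_dist; case: pselect => [e|ne].
  case: ex_minnP => k /asboolP abk kmin; apply: FirstDiffNeq => // i ik.
  by apply: contrapT => /asboolP /kmin; rewrite leqNgt ik.
apply: FirstDiffEq; apply/funext => n; apply: contrapT => abn.
by apply: ne; exists n; apply/asboolP.
Qed.

Lemma first_diff_dist_ge a b k : a k <> b k ->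
  k.+1%:R^-1 <= first_diff_dist a b.
Proof.
case: first_diff_distP => [-> //|j _ ab abk].
rewrite lef_pV2 ?posrE ?ltr0n// ler_nat ltnS leqNgt.
by apply/negP => /ab.
Qed.

Lemma first_diff_dist_ge0 a b : 0 <= first_diff_dist a b.
Proof. by case: first_diff_distP. Qed.

(** Balls of radius 1/(n+1) are thus cylinders over the first n+1 entries. *)
Lemma first_diff_dist_lt a b n :
  (first_diff_dist a b < n.+1%:R^-1) <-> (forall i, (i <= n)%N -> a i = b i).
Proof.
split=> [abn i le_in|]; last first.
  case: first_diff_distP => [_ _|k abk _ ab]; first by rewrite invr_gt0 ltr0n.
  rewrite ltf_pV2 ?posrE ?ltr0n// ltr_nat ltnS ltnNge.
  by apply/negP => /ab.
apply: contrapT => /first_diff_dist_ge; apply/negP; rewrite -ltNge.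
apply: lt_le_trans abn _.
by rewrite lef_pV2 ?posrE ?ltr0n// ler_nat ltnS.
Qed.

Lemma first_diff_distxx a : first_diff_dist a a = 0.
Proof. by case: first_diff_distP. Qed.

Lemma first_diff_dist_eq0 a b : first_diff_dist a b = 0 -> a = b.
Proof.
by case: first_diff_distP => // k _ _ /eqP; rewrite invr_eq0 pnatr_eq0.
Qed.

Lemma first_diff_dist_sym a b : first_diff_dist a b = first_diff_dist b a.
Proof.
have le_sym u v : first_diff_dist u v <= first_diff_dist v u.
  case: (first_diff_distP u v) => [_|k uvk _]; first exact: first_diff_dist_ge0.
  by apply: first_diff_dist_ge => /esym.
by apply/eqP; rewrite eq_le !le_sym.
Qed.

Lemma first_diff_dist_triangle b a c :
  first_diff_dist a c <= first_diff_dist a b + first_diff_dist b c.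
Proof.
case: (first_diff_distP a c) => [_|k ack _].
  by rewrite addr_ge0 ?first_diff_dist_ge0.
(* At the index [k], where [a] and [c] differ, [b] must differ from one of them, so one summand
   alone is large enough. *)
have [abk|abk] := pselect (a k = b k).
  by rewrite ler_wpDl ?first_diff_dist_ge0// first_diff_dist_ge// -abk.
by rewrite ler_wpDr ?first_diff_dist_ge0// first_diff_dist_ge.
Qed.

End FirstDifference.

(** * Ponomarev's space and its projection to [X] *)

Section Ponomarev.
Import Order.TTheory GRing.Theory Num.Theory.
Local Open Scope ring_scope.

Definition open_basis_seq {X : topologicalType} (p : X) (B : nat -> set X) :=
  (forall n, open (B n) /\ B n p) /\
  (forall U, nbhs p U -> exists n, B n `<=` U).

Lemma first_countable_open_basis_seq (X : topologicalType) (p : X) :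
  first_countable X -> exists B, open_basis_seq p B.
Proof.
move=> /(_ p)[C /pcard_leP /unsquash f [Cp pC]].
(* The injection [f] numbers the countable basis [C]. Its members are only neighbourhoods, hence the
   interiors; numbers outside the image of [f] get [setT]. *)
pose B n := if pselect (exists2 A, C A & f A = n) is left e
  then (sval (cid2 e))^° else setT.
exists B; split=> [n|U /pC[A CA AU]].
  rewrite /B; case: pselect => [e|_]; last by split=> //; exact: openT.
  case: cid2 => A CA _ /=; split; first exact: open_interior.
  exact: (Cp _ CA).
exists (f A); rewrite /B; case: pselect => [e|[]]; last by exists A.
case: cid2 => A' CA' /= fAA'.
have -> : A' = A by apply: (@inj _ _ _ f); rewrite ?inE.
exact: subset_trans (@interior_subset _ _) AU.
Qed.

(** Any neighbourhoods of [p] and of [q] contain members of [B], and [p] lies in all of these, so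
    the two neighbourhoods meet. *)
Lemma hausdorff_open_basis_seq_inj (X : topologicalType) (p q : X) B :
  hausdorff_space X -> open_basis_seq p B -> open_basis_seq q B -> p = q.
Proof.
move=> hX [Bp pB] [Bq qB]; apply: hX => U W /pB[n BU] /qB[m BW].
exists p; split; first by apply: BU; exact: (Bp n).2.
by apply: BW; exact: (Bp m).2.
Qed.

(* [hX] is a parameter because the metric separates points only when a sequence
   of sets is a basis at no more than one point. *)
Record ponomarev (R : realType) (X : topologicalType) (hX : hausdorff_space X)
  := Ponomarev {
  ponomarev_pt : X ;
  ponomarev_seq : nat -> set X ;
  ponomarevP : open_basis_seq ponomarev_pt ponomarev_seq }.

Context {R : realType} {X : topologicalType} {hX : hausdorff_space X}.
Local Notation Y := (ponomarev R hX).

HB.instance Definition _ := gen_eqMixin Y.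
HB.instance Definition _ := gen_choiceMixin Y.

Let dist (y z : Y) : R :=
  first_diff_dist (ponomarev_seq y) (ponomarev_seq z).

Let dist_eq0 (y z : Y) : dist y z = 0 -> y = z.
Proof.
case: y z => [p B pB] [q C qC] /first_diff_dist_eq0 /= BC.
move: qC; rewrite -{}BC => qB.
move: (qB); rewrite -(hausdorff_open_basis_seq_inj hX pB qB) => pB'.
by rewrite (Prop_irrelevance pB pB').
Qed.

HB.instance Definition _ := isMetric.Build R Y
  (fun y => first_diff_distxx (ponomarev_seq y)) dist_eq0
  (fun y z => first_diff_dist_sym (ponomarev_seq y) (ponomarev_seq z))
  (fun y x z => first_diff_dist_triangle (ponomarev_seq y)
     (ponomarev_seq x) (ponomarev_seq z)).

Lemma nbhs_ponomarevP (y : Y) (A : set Y) : nbhs y A <->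
  exists n, forall z : Y,
    (forall i, (i <= n)%N -> ponomarev_seq y i = ponomarev_seq z i) -> A z.
Proof.
rewrite -nbhs_ballE; split=> [[e /= e0 yA]|[n nA]].
  have [n _ ne] := near_infty_natSinv_lt (PosNum e0).
  exists n => z yz; apply: yA; rewrite ballEmdist/=.
  by apply: lt_trans (ne n (leqnn n)); exact/first_diff_dist_lt.
exists n.+1%:R^-1; first by rewrite /= invr_gt0 ltr0n.
by move=> z; rewrite ballEmdist/= => /first_diff_dist_lt; exact: nA.
Qed.

Lemma ponomarev_pt_continuous : continuous (@ponomarev_pt R X hX : Y -> X).
Proof.
move=> y U /(ponomarevP y).2[n BU]; apply/nbhs_ponomarevP; exists n => z yz.
by apply: BU; rewrite yz//; exact: ((ponomarevP z).1 n).2.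
Qed.

(** The image of a cylinder contains the intersection of the finitely many open sets that define it:
    any point there has a basis sequence starting with these sets. *)
Lemma ponomarev_pt_open_map : first_countable X ->
  open_map (@ponomarev_pt R X hX : Y -> X).
Proof.
move=> cX A; rewrite openE => oA; rewrite openE => _ [y Ay <-].
have /nbhs_ponomarevP[n nA] := oA _ Ay.
have Bopen i : nbhs (ponomarev_pt y) (ponomarev_seq y i).
  by have [oB By] := (ponomarevP y).1 i; exact: open_nbhs_nbhs.
have : \forall x \near ponomarev_pt y,
    forall i : 'I_n.+1, ponomarev_seq y i x.
  by apply: filter_forall => i; exact: Bopen.
apply: filterS => x Bx.
have [C [Cx xC]] := first_countable_open_basis_seq x cX.
(* The first n+1 entries of [y] keep [D] in the cylinder; the shifted copy of [C] makes it a basis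
   at [x]. *)
pose D i := if (i <= n)%N then ponomarev_seq y i else C (i - n.+1)%N.
have xD : open_basis_seq x D.
  split=> [i|U /xC[k CU]].
    rewrite /D; case: leqP => [le_in|_]; last exact: Cx.
    split; first exact: ((ponomarevP y).1 i).1.
    exact: (Bx (Ordinal (le_in : i < n.+1)%N)).
  by exists (n.+1 + k)%N; rewrite /D leqNgt leq_addr/= addKn.
exists (@Ponomarev R X hX _ _ xD) => //; apply: nA => i le_in.
by rewrite /= /D le_in.
Qed.

Lemma ponomarev_pt_surj : first_countable X ->
  set_surj [set: Y] [set: X] (@ponomarev_pt R X hX).
Proof.
move=> cX x _; have [B xB] := first_countable_open_basis_seq x cX.
by exists (@Ponomarev R X hX _ _ xB).
Qed.

End Ponomarev.

Lemma first_countable_open_image_metric (R : realType) (X : topologicalType) :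
  first_countable X -> hausdorff_space X ->
  exists (Y : metricType R) (f : Y -> X),
    [/\ continuous f, open_map f & set_surj [set: Y] [set: X] f].
Proof.
move=> cX hX; exists (ponomarev R hX : metricType R), (@ponomarev_pt R X hX).
split; first exact: ponomarev_pt_continuous.
- exact: ponomarev_pt_open_map.
- exact: ponomarev_pt_surj.
Qed.

(** * Building plays against a given strategy *)

Section ChoquetPlays.
Context {X : topologicalType}.

(** Legality recurses from the oldest round, whereas a play grows at its newest end. *)
Lemma legal_after_rcons (W : set X) h m V m' : legal_after W h m ->
  legal_nonempty m V -> legal_empty V m' ->
  legal_after W (rcons h (m, V)) m'.
Proof.
move=> + mV Vm'; elim: h W => [|[m1 V1] h IH] W /=; first by split.
by move=> [? ? /IH].
Qed.

Lemma legal_play_decr (m : nat -> empty_move X) V i j : legal_play m V ->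
  (i <= j)%N -> V j `<=` V i.
Proof.
move=> mV /subnK <-; elim: (j - i)%N => [|k IH]; first exact: subset_refl.
apply: subset_trans IH; rewrite addSn.
have [/=] := mV (k + i).+1; case: (m _) => x U [_ _ UV] [_ _ VU].
exact: subset_trans VU UV.
Qed.

(** Dependent choice for Empty: [Q] is whatever Empty can secure between consecutive moves,
    regardless of how Nonempty answers. *)
Lemma play_against_strategy
    (S : seq (round X) -> empty_move X -> nonempty_move X)
    (Q : empty_move X -> set X -> empty_move X -> Prop) (m0 : empty_move X) :
  is_strategy S -> legal_empty setT m0 ->
  (forall m V, legal_nonempty m V ->
     exists m', legal_empty V m' /\ Q m V m') ->
  exists m V, [/\ legal_play m V, follows S m V &
    forall n, Q (m n) (V n) (m n.+1)].
Proof.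
move=> stS m0l Qex.
(* Guarding by legality makes [reply] a total function, with [m0] as its value on illegal rounds. *)
have /choice[reply replyP] (mV : round X) : exists m',
    legal_nonempty mV.1 mV.2 -> legal_empty mV.2 m' /\ Q mV.1 mV.2 m'.
  have [/Qex[m' ?]|?] := pselect (legal_nonempty mV.1 mV.2); first by exists m'.
  by exists m0.
pose step (hm : seq (round X) * empty_move X) :=
  let mV := (hm.2, S hm.1 hm.2) in (rcons hm.1 mV, reply mV).
pose run n := iter n step ([::], m0).
pose m n := (run n).2.
pose V n := S (run n).1 (m n).
have runS n : run n.+1 = (rcons (run n).1 (m n, V n), reply (m n, V n)) by [].
have run1 n : (run n).1 = mkseq (fun i => (m i, V i)) n.
  elim: n => // n IH.
  by rewrite runS IH /mkseq -addn1 iotaD map_cat cats1.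
(* [S] is constrained only on legal partial plays, so the legality of the whole history is carried
   through the induction. *)
have legal n : legal_partial_play (run n).1 (m n).
  elim: n => // n IH; have mVl := stS _ _ IH.
  by rewrite /m runS; apply: legal_after_rcons => //;
    exact: (replyP (m n, V n) mVl).1.
exists m, V; split.
- move=> i; split; last exact: stS.
  case: i => // i; exact: (replyP (m i, V i) (stS _ _ (legal i))).1.
- by move=> n; rewrite -run1.
- move=> n; exact: (replyP (m n, V n) (stS _ _ (legal n))).2.
Qed.

End ChoquetPlays.

(** * The Sorgenfrey line and Empty's play on it *)

(** A separate name keeps the half-open topology apart from the standard one on [R]. *)
Definition sorgenfrey (R : realType) : Type := R.

Section Sorgenfrey.
Import Order.TTheory GRing.Theory Num.Theory.
Local Open Scope ring_scope.
Context {R : realType}.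
Local Notation X := (sorgenfrey R).

HB.instance Definition _ := Choice.copy X R.

Let right_open (A : set X) := forall x : R, A x ->
  exists2 e : R, 0 < e & forall y : R, x <= y < x + e -> A y.

Let right_openT : right_open setT.
Proof. by move=> x _; exists 1. Qed.

Let right_openI : setI_closed right_open.
Proof.
move=> A B oA oB x [/oA[e e0 eA] /oB[d d0 dB]].
exists (Num.min e d); first by rewrite lt_min e0.
move=> y /andP[xy]; rewrite -ltrBlDl lt_min => /andP[ye yd].
by split; [apply: eA|apply: dB]; rewrite xy -ltrBlDl.
Qed.

Let right_open_bigU (I : Type) (f : I -> set X) :
  (forall i, right_open (f i)) -> right_open (\bigcup_i f i).
Proof.
move=> of_ x [i _ /of_[e e0 ef]]; exists e => // y xy.
by exists i => //; exact: ef.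
Qed.

HB.instance Definition _ := isOpenTopological.Build X
  right_openT right_openI right_open_bigU.

Lemma nbhs_sorgenfreyP (x : X) (A : set X) : nbhs x A <->
  exists2 e : R, 0 < e & forall y : R, (x : R) <= y < x + e -> A y.
Proof.
rewrite nbhsE; split=> [[B [oB Bx] BA]|[e e0 eA]].
  have [e e0 eB] := oB x Bx; exists e => // y xy; exact/BA/eB.
exists [set y : X | (x : R) <= (y : R) < x + e]; last exact: eA.
split; last by rewrite /= lexx ltrDl.
move=> y /andP[xy yx]; exists (x + e - y); first by rewrite subr_gt0.
by move=> z /= yz; lra.
Qed.

Lemma sorgenfrey_open_itv (a b : R) : open ([set y : R | a <= y < b] : set X).
Proof.
rewrite openE => y /= /andP[ay yb]; apply/nbhs_sorgenfreyP.
exists (b - y); first by rewrite subr_gt0.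
by move=> z /= yz; lra.
Qed.

Lemma sorgenfrey_first_countable : first_countable X.
Proof.
move=> p; exists (range (fun n => [set y : R | p <= y < p + n.+1%:R^-1])).
  exact: card_le_trans (card_image_le _ _) (countableP _).
split=> [_ [n _ <-]|A /nbhs_sorgenfreyP[e e0 eA]].
  by apply/nbhs_sorgenfreyP; exists n.+1%:R^-1; rewrite ?invr_gt0 ?ltr0n.
have [n _ ne] := near_infty_natSinv_lt (PosNum e0).
eexists; first by exists n.
move=> y /andP[py yp]; apply: eA; rewrite py (lt_trans yp)// ltrD2l.
exact: ne n (leqnn n).
Qed.

Lemma sorgenfrey_hausdorff : hausdorff_space X.
Proof.
suff lt_sep (p q : R) : p < q -> exists A B : set X,
    [/\ nbhs (p : X) A, nbhs (q : X) B & A `&` B = set0].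
  move=> p q pq; apply: contrapT => /eqP; rewrite (@neq_lt _ R).
  move=> /orP[] /lt_sep[A [B [pA qB AB]]].
    by have /set0P := pq _ _ pA qB; rewrite AB eqxx.
  by have /set0P := pq _ _ qB pA; rewrite setIC AB eqxx.
move=> pq; exists [set y : R | p <= y < q], [set y : R | q <= y < q + 1].
split.
- apply/nbhs_sorgenfreyP; exists (q - p); first by rewrite subr_gt0.
  by move=> y; rewrite addrC subrK.
- by apply/nbhs_sorgenfreyP; exists 1.
- rewrite -subset0 => y [/andP[_ yq] /andP[qy _]].
  by move: yq; rewrite ltNge qy.
Qed.

Lemma sorgenfrey_no_convergent_strategy :
  ~ (exists S : seq (round X) -> empty_move X -> nonempty_move X,
       is_strategy S /\ convergent S).
Proof.
move=> [S [stS cvS]].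
(* The interval is closed at [b] because the supremum of the points is only known to be at most
   [b]. *)
pose Q (m : empty_move X) (V : set X) (m' : empty_move X) :=
  (m.1 : R) < m'.1 /\ exists b : R,
    (forall z : R, m'.2 z -> z < b) /\
    (forall z : R, (m.1 : R) <= z <= b -> V z).
have [||m [V [mV SV QmV]]] :=
    @play_against_strategy X S Q ((0 : R) : X, setT) stS.
- by split=> //; exact: openT.
- move=> [x U] V [oV Vx _].
  have /nbhs_sorgenfreyP[e e0 eV] : nbhs x V by exact: open_nbhs_nbhs.
  (* As [V] contains [x, x + e), any point strictly between x and x + e can serve as [b], and any
     point strictly between x and [b] as the next point. *)
  exists ((x + e / 4 : R) : X, [set z : R | x + e / 4 <= z < x + e / 2]).
  split; first split.
  + exact: sorgenfrey_open_itv.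
  + by rewrite /= lexx/=; lra.
  + by move=> z /= zx; apply: eV; lra.
  split=> /=; first by lra.
  exists (x + e / 2); split=> z zx; first by lra.
  by apply: eV; lra.
pose x n : R := (m n).1.
have Vx n : V n (x n).
  by have [_] := mV n; rewrite /x; case: (m n) => ? ? [].
have xS n : x n < x n.+1 by have [] := QmV n.
have Vsub n k : (n <= k)%N -> V k `<=` (m n).2.
  move=> nk; apply: subset_trans (legal_play_decr mV nk) _.
  by have [_] := mV n; case: (m n) => ? ? [].
have bounded n : exists b : R, ubound (range x) b /\
    (forall z : R, x n <= z <= b -> V n z).
  have [_ [b [mb bV]]] := QmV n; exists b; split=> // _ [k _ <-].
  (* Points from round n+1 on lie in Empty's set of that round, which is below [b]; earlier points
     are below x_(n+1) by monotonicity. *)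
  have [nk|kn] := leqP n.+1 k.
    by apply/ltW/mb; exact: Vsub nk _ (Vx k).
  apply: (@le_trans _ _ (x n.+1)).
    by move/increasing_seqP: xS => ->; exact: ltnW.
  by apply/ltW/mb; exact: Vsub (leqnn _) _ (Vx n.+1).
have x_le_sup n : x n <= sup (range x).
  have [b [xb _]] := bounded 0%N.
  by apply: ub_le_sup; [exists b|exists n].
have Vsup n : V n (sup (range x)).
  have [b [xb bV]] := bounded n; apply: bV; rewrite x_le_sup/=.
  by apply: ge_sup => //; exists (x 0%N), 0%N.
have [_ basis] := cvS _ _ mV SV (sup (range x) : X) (fun n _ => Vsup n).
(* This ray is a neighbourhood of the supremum that misses every [x n], since the sequence increases
   strictly. *)
have /basis[_ [n _ <-] VA] :
    nbhs (sup (range x) : X) ([set y : R | sup (range x) <= y] : set X).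
  by apply/nbhs_sorgenfreyP; exists 1 => // y /andP[].
have := VA _ (Vx n); rewrite /= leNgt => /negP; apply.
exact: lt_le_trans (xS n) (x_le_sup n.+1).
Qed.

End Sorgenfrey.

Theorem mainTheorem7 (R : realType) :
  exists X : topologicalType,
    [/\ first_countable X,
        hausdorff_space X,
        ~ (exists S : seq (round X) -> empty_move X -> nonempty_move X,
             is_strategy S /\ convergent S) &
        exists (Y : metricType R) (f : Y -> X),
          [/\ continuous f, open_map f & set_surj [set: Y] [set: X] f]].
Proof.
exists (sorgenfrey R); split.
- exact: sorgenfrey_first_countable.
- exact: sorgenfrey_hausdorff.
- exact: sorgenfrey_no_convergent_strategy.
- apply: first_countable_open_image_metric.
    exact: sorgenfrey_first_countable.
  exact: sorgenfrey_hausdorff.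
Qed.
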